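(* Let $n\ge 3$ and let $(W,\star)$ be the Norton algebra associated with the action of $S_n$ on two-element subsets of $\{1,\dots,n\}$ described in the context. Then $(W,\star)$ admits $2$-nilpotents (non-zero $w\in W$ with $w\star w=0$) if and only if $n$ is even. In such a case (that is, when $n$ is even), for $w\in W$ one has $w\star w=0$ if and only if $w=\alpha\left(\sum_{i\in I}f_i-\sum_{i\notin I}f_i\right)$ for some $\alpha\in\mathbb C$ and some $I\subset\{1,\dots,n\}$ with $|I|=n/2$.
   Context: Let $\Omega=\{\{i,j\}:1\le i<j\le n\}$ with the natural action of $S_n$, and let $U=\mathbb C^{\Omega}$ be the permutation representation with standard basis $\{e_{ij}\}_{1\le i<j\le n}$ (write $e_{ij}=e_{ji}$), endowed with componentwise multiplication $u\cdot v$ (so $e_{ij}\cdot e_{ij}=e_{ij}$ and distinct basis vectors multiply to $0$) and the standard Hermitian inner product, for which the $e_{ij}$ are orthonormal. Put $f_i=\sum_{j\ne i}e_{ij}$ for $1\le i\le n$, and $$W=\Big\{\sum_{i=1}^n z_if_i : z_i\in\mathbb C,\ \sum_{i=1}^n z_i=0\Big\},$$ an $S_n$-invariant subspace of $U$. Let $P:U\to W$ be the orthogonal projection. The Norton algebra product on $W$ is $w_1\star w_2:=P(w_1\cdot w_2)$.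
   Formalization: For n = 4 every w in W satisfies w⋆w = 0 (e.g. f_1 − f_2, which is not of the stated form), so the implication from w⋆w = 0 to w = α(Σ_{i∈I} f_i − Σ_{i∉I} f_i) is stated only for even n ≠ 4; all else holds for n ≥ 3. *)

(* Defs.v *)
From mathcomp Require Import all_boot all_order all_algebra.
From mathcomp Require Import reals complex.

Set Implicit Arguments.
Unset Strict Implicit.
Unset Printing Implicit Defensive.
Import GRing.Theory.

Local Open Scope ring_scope.

(* The index set Omega of the two-element subsets of {0, ..., n-1}. *)
Definition Omega (n : nat) : finType := {A : {set 'I_n} | #|A| == 2%N}.

(* U = C^Omega, as row vectors indexed by the enumeration of Omega: this gives
   access to the library's standard Hermitian product (dotmx) and its
   orthogonal projections (proj_ortho), which act on the right. *)
Definition U (R : realType) (n : nat) := 'rV[R[i]]_#|Omega n|.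

Definition mulU (R : realType) (n : nat) (u v : U R n) : U R n :=
  \row_k (u 0 k * v 0 k).

(* The standard basis vector of {i, j} when i != j; the junk value at i = j is
   0 and is never used. *)
Definition e (R : realType) (n : nat) (i j : 'I_n) : U R n :=
  \row_k (val (enum_val k) == [set i; j])%:R.

Definition f (R : realType) (n : nat) (i : 'I_n) : U R n :=
  \sum_(j < n | j != i) e R i j.

(* The row space of this matrix is W: the rows z with \sum_i z_i = 0 form the
   kernel of the all-ones column, and z is sent to \sum_i z_i f_i (see WP). *)
Definition W (R : realType) (n : nat) : 'M[R[i]]_(n, #|Omega n|) :=
  kermx (const_mx 1 : 'cV[R[i]]_n) *m \matrix_(i < n) f R i.

Lemma WP (R : realType) (n : nat) (w : U R n) :
  reflect (exists2 z : 'I_n -> R[i],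
             \sum_(i < n) z i = 0 & w = \sum_(i < n) z i *: f R i)
          (w <= W R n)%MS.
Proof.
apply: (iffP submxP) => [[y ->]|[z z0 ->]].
  exists (fun i => (y *m kermx (const_mx 1 : 'cV[R[i]]_n)) 0 i).
    have /matrixP/(_ 0 0) : y *m kermx (const_mx 1 : 'cV[R[i]]_n)
        *m (const_mx 1 : 'cV[R[i]]_n) = 0 by rewrite -mulmxA mulmx_ker mulmx0.
    rewrite mxE [RHS]mxE => y0; rewrite -[RHS]y0; apply: eq_bigr => i _.
    by rewrite [const_mx _ _ _]mxE mulr1.
  by rewrite /W mulmxA mulmx_sum_row; apply: eq_bigr => i _; rewrite rowK.
have /submxP[y zE] : (\row_i z i <= kermx (const_mx 1 : 'cV[R[i]]_n))%MS.
  apply/sub_kermxP/matrixP => a b; rewrite !mxE -[RHS]z0.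
  by apply: eq_bigr => i _; rewrite !mxE mulr1.
exists y; rewrite /W mulmxA -zE mulmx_sum_row.
by apply: eq_bigr => i _; rewrite rowK mxE.
Qed.

Definition P (R : realType) (n : nat) (u : U R n) : U R n :=
  u *m proj_ortho (W R n).

Definition norton (R : realType) (n : nat) (w1 w2 : U R n) : U R n :=
  P (mulU w1 w2).

(* Main.v *)
(** For w = \sum_i z_i f_i with \sum_i z_i = 0, the entry of w at {i, j} is
    z_i + z_j, so <w w, f_i> = \sum_(j != i) (z_i + z_j)^2
    = (n - 4) z_i^2 + \sum_j z_j^2. Orthogonality of w w to W means that this is
    independent of i; for n <> 4 all the z_i are then equal up to sign, and
    \sum_i z_i = 0 forces as many plus signs as minus signs unless w = 0. *)

Require Import Defs.
From mathcomp Require Import all_boot all_order all_algebra.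
From mathcomp Require Import reals complex.
From mathcomp Require Import ring.
Local Open Scope ring_scope.
Import GRing.Theory Num.Theory.

(** An orthogonal projection kills exactly the orthogonal complement of its image; matrix
    orthogonality is unfolded here into coordinate sums. *)
Lemma proj_ortho_eq0 (C : numClosedFieldType) (p n : nat)
    (A : 'M[C]_(p, n)) (u : 'rV[C]_n) :
  u *m proj_ortho A = 0 <->
  forall v : 'rV[C]_n, (v <= A)%MS -> \sum_k u 0 k * (v 0 k)^* = 0.
Proof.
have uv0 (v : 'rV[C]_n) :
    (u <= orthomx Num.Def.conjC (hermitian1mx n) v)%MS
    <-> \sum_k u 0 k * (v 0 k)^* = 0.
  have E : (u *m (v ^t Num.Def.conjC)%sesqui) 0 0 = \sum_k u 0 k * (v 0 k)^*.
    by rewrite mxE; apply: eq_bigr => k _; rewrite !mxE.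
  split=> [/orthomx1P uv|uv]; first by rewrite -E uv mxE.
  by apply/orthomx1P/rowP => i; rewrite ord1 E uv mxE.
split=> [uA v vA|uA].
  apply/uv0; have := proj_ortho_compl_sub A u.
  by rewrite uA subr0 => /orthomxP; apply.
apply/proj_ortho_0/orthomxP => u' v u'u vA.
by apply: submx_trans u'u _; apply/uv0/uA.
Qed.

Section NortonSquares.
Context {R : realType} {n : nat}.
Implicit Types (i j : 'I_n) (z : 'I_n -> R[i]).

Definition comb z : U R n := \sum_i z i *: f R i.

Lemma f_entry i k : f R i 0 k = (i \in val (enum_val k))%:R.
Proof.
rewrite /f summxE; under eq_bigr do rewrite mxE.
case: (enum_val k) => A /= /cards2P[a [b [ab Aab]]].
have [iA|iA] := boolP (i \in A); last first.
  rewrite big1 // => j _; case: eqP => // AE.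
  by rewrite AE !inE eqxx in iA.
have [c ci AE] : exists2 c, c != i & A = [set i; c].
  move: iA; rewrite Aab !inE => /orP[]/eqP ->.
    by exists b; rewrite // eq_sym.
  by exists a; rewrite // setUC.
rewrite (bigD1 c) //= AE eqxx big1 ?addr0 // => j /andP[ji jc].
case: eqP => // /setP/(_ j).
by rewrite !inE eqxx orbT (negPf ji) (negPf jc).
Qed.

Lemma comb_entry z k : comb z 0 k = \sum_(i in val (enum_val k)) z i.
Proof.
rewrite summxE [RHS]big_mkcond; apply: eq_bigr => i _.
by rewrite mxE f_entry; case: ifP; rewrite ?mulr1 ?mulr0.
Qed.

(** [f R i] is the indicator of the pairs containing [i]. Letting [G] act on all sets keeps
    cardinality proofs out of the sum. *)
Lemma sum_f_pairs (G : {set 'I_n} -> R[i]) i :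
  \sum_k G (val (enum_val k)) * f R i 0 k = \sum_(j | j != i) G [set i; j].
Proof.
under eq_bigr do rewrite /f summxE mulr_sumr.
rewrite exchange_big; apply: eq_bigr => j ji.
have ij2 : #|[set i; j]| == 2%N by rewrite cards2 (eq_sym i) ji.
rewrite (bigD1 (enum_rank (Sub [set i; j] ij2 : Omega n))) //=.
rewrite mxE enum_rankK eqxx mulr1 big1 ?addr0 // => k kij.
rewrite mxE; case: eqP; rewrite ?mulr0 // => kE; case/eqP: kij.
by apply: enum_val_inj; rewrite enum_rankK; apply: val_inj.
Qed.

Lemma sum_sqr_f z i : \sum_j z j = 0 ->
  \sum_k mulU (comb z) (comb z) 0 k * f R i 0 k
  = (n%:R - 4) * z i ^+ 2 + \sum_j z j ^+ 2.
Proof.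
move=> z0; under eq_bigr do rewrite mxE comb_entry.
rewrite (sum_f_pairs (fun A => (\sum_(l in A) z l) * (\sum_(l in A) z l))).
have zi : \sum_(j | j != i) z j = - z i.
  by move: z0; rewrite (bigD1 i) //= addrC => /eqP; rewrite addr_eq0 => /eqP.
(* The coefficient n - 4 is (n - 1) - 2 - 1: n - 1 copies of the first square, cross terms summing
   to -2 z_i^2 by [zi], and the square missing from the last sum. *)
transitivity (\sum_(j | j != i) (z i ^+ 2 + 2 * z i * z j + z j ^+ 2)).
  apply: eq_bigr => j ji.
  by rewrite big_setU1 ?inE 1?eq_sym //= big_set1; ring.
rewrite !big_split /= sumr_const -mulr_sumr zi [\sum_j z j ^+ 2](bigD1 i) //=.
rewrite -[X in _ *+ X]/#|predC1 i| cardC1 card_ord.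
have -> : n%:R = 1 + n.-1%:R :> R[i].
  by rewrite nat1r prednK // (leq_trans _ (ltn_ord i)).
by rewrite -[_ *+ n.-1]mulr_natr; ring.
Qed.

(** The entries of [f] are 0 or 1, so conjugation affects only the coefficients. *)
Lemma dotmx_comb (u : U R n) z :
  \sum_k u 0 k * (comb z 0 k)^* = \sum_i (z i)^* * \sum_k u 0 k * f R i 0 k.
Proof.
under [RHS]eq_bigr do rewrite mulr_sumr.
rewrite exchange_big; apply: eq_bigr => k _ /=.
rewrite summxE rmorph_sum mulr_sumr; apply: eq_bigr => i _.
by rewrite mxE rmorphM f_entry rmorph_nat mulrCA.
Qed.

Lemma norton_sqr_eq0 z : \sum_j z j = 0 ->
  norton (comb z) (comb z) = 0 <->
  forall i j, (n%:R - 4) * z i ^+ 2 = (n%:R - 4) * z j ^+ 2.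
Proof.
move=> z0; rewrite /norton /P proj_ortho_eq0; split=> [zW i j|zc v /WP[y y0 ->]].
  (* Test against f_i - f_j, which lies in [W]. *)
  pose y (l : 'I_n) : R[i] := (l == i)%:R - (l == j)%:R.
  have delta (F : 'I_n -> R[i]) (l : 'I_n) : \sum_m (m == l)%:R * F m = F l.
    rewrite (bigD1 l) //= eqxx mul1r big1 ?addr0 // => m /negPf ->.
    by rewrite mul0r.
  have y0 : \sum_l y l = 0.
    have d1 (l : 'I_n) : \sum_m (m == l)%:R = 1 :> R[i].
      by rewrite -[RHS](delta (fun=> 1) l); apply: eq_bigr => m _; rewrite mulr1.
    by rewrite sumrB !d1 subrr.
  have /zW : (comb y <= W R n)%MS by apply/WP; exists y.
  rewrite dotmx_comb; under eq_bigr do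
    rewrite sum_sqr_f // rmorphB !rmorph_nat mulrBl.
  by rewrite sumrB !delta => /subr0_eq /addIr.
rewrite dotmx_comb.
(* The common value at a reference index [i0] factors out, leaving the conjugate of the zero sum of
   [y]; for n = 0 there is no such index. *)
have [n0|[i0]] : n = 0%N \/ exists i : 'I_n, true.
- by case: (n) => [|m]; [left|right; exists ord0].
- by apply: big1 => -[m lm]; exfalso; rewrite n0 in lm.
under eq_bigr => i _ do rewrite sum_sqr_f // (zc i i0).
by rewrite -mulr_suml -rmorph_sum y0 rmorph0 mul0r.
Qed.

(** The factorization shows that the sum vanishes only when [I] is balanced or [a] is 0; both
    directions of the characterization use it. *)
Lemma sum_signs (I : {set 'I_n}) (a : R[i]) :
  \sum_i (if i \in I then a else - a) = (#|I|.*2%:R - n%:R) * a.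
Proof.
rewrite big_if /= !sumr_const -[X in _ + _ *+ X]/#|[predC I]|.
have -> : n%:R = #|I|%:R + #|[predC I]|%:R :> R[i].
  by rewrite -natrD cardC card_ord.
by rewrite -addnn natrD -(mulr_natr a) -(mulr_natr (- a)); ring.
Qed.

Lemma comb_signs (I : {set 'I_n}) (a : R[i]) :
  a *: (\sum_(i in I) f R i - \sum_(i in ~: I) f R i)
  = comb (fun i => if i \in I then a else - a).
Proof.
rewrite /comb [RHS](bigID (mem I)) /= scalerBr -scaleNr !scaler_sumr.
congr (_ + _); first by apply: eq_bigr => i ->.
by apply: eq_big => i; rewrite inE // => /negPf ->.
Qed.

Lemma norton_signs (I : {set 'I_n}) (a : R[i]) : ~~ odd n -> #|I| = n./2 ->
  let w := a *: (\sum_(i in I) f R i - \sum_(i in ~: I) f R i) in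
  (w <= W R n)%MS /\ norton w w = 0.
Proof.
move=> n_even cI w; rewrite /w comb_signs.
set z := fun i => _; have z0 : \sum_i z i = 0.
  by rewrite sum_signs cI even_halfK // subrr mul0r.
split; first by apply/WP; exists z.
apply/norton_sqr_eq0 => // i j; congr (_ * _).
by rewrite /z; do 2!case: ifP; rewrite ?sqrrN.
Qed.

Lemma norton_sqr_eq0_signs (w : U R n) : (0 < n)%N -> n <> 4%N ->
  (w <= W R n)%MS -> norton w w = 0 -> w <> 0 ->
  exists (a : R[i]) (I : {set 'I_n}), #|I|.*2 = n /\
    w = a *: (\sum_(i in I) f R i - \sum_(i in ~: I) f R i).
Proof.
move=> n0 n4 /WP[z z0 ->] /(norton_sqr_eq0 z z0) zc w0.
have n4C : n%:R - 4 != 0 :> R[i] by rewrite subr_eq0 eqr_nat; apply/eqP.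
(* All squares agree, so each coefficient is that of [i0] up to sign, and [I] collects the plus
   signs. *)
pose i0 := Ordinal n0; pose I := [set i | z i == z i0].
have zE i : z i = if i \in I then z i0 else - z i0.
  rewrite inE; case: ifPn => [/eqP //|zi].
  by have /eqP := mulfI n4C (zc i i0); rewrite eqf_sqr (negPf zi) => /eqP.
exists (z i0), I; split; last first.
  by rewrite comb_signs; apply: eq_bigr => i _; rewrite -zE.
move: z0; under eq_bigr do rewrite zE.
rewrite sum_signs => /eqP; rewrite mulf_eq0 subr_eq0 eqr_nat => /orP[/eqP //|zi0].
case: w0; apply: big1 => i _.
by rewrite zE (eqP zi0) oppr0 if_same scale0r.
Qed.

End NortonSquares.

Lemma exists_card_set (T : finType) (m : nat) : (m <= #|T|)%N ->
  exists A : {set T}, #|A| = m.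
Proof.
move=> mT; exists [set x in take m (enum T)].
by rewrite cardsE (card_uniqP _) ?take_uniq ?enum_uniq // size_takel // -cardE.
Qed.

(* At n = 4 every element of W squares to 0 (its entries at complementary pairs
   are opposite), so there the characterization holds in one direction only. *)
Theorem proposition6p11 (R : realType) (n : nat) (hn : (3 <= n)%N) :
  ((exists w : U R n,
      [/\ (w <= W R n)%MS, w <> 0 & norton w w = 0]) <-> ~~ odd n)
  /\
  (~~ odd n ->
   forall w : U R n, (w <= W R n)%MS ->
     let balanced :=
       exists (alpha : R[i]) (I : {set 'I_n}),
         #|I| = (n./2)%N /\
         w = alpha *: (\sum_(i in I) f R i - \sum_(i in ~: I) f R i) in
     (balanced -> norton w w = 0) /\
     (n <> 4%N -> norton w w = 0 -> balanced)).
Proof.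
have half_set : exists I : {set 'I_n}, #|I| = n./2.
  by apply: exists_card_set; rewrite card_ord -divn2 leq_div.
have n0 : (0 < n)%N by apply: leq_trans hn.
split; [split=> [[w [wW w0 ww0]]|n_even]|].
(* The sign description fails at n = 4, but 4 is even anyway. *)
- have [->//|/eqP n4] := eqVneq n 4%N.
  have [a [I [cI _]]] := norton_sqr_eq0_signs w n0 n4 wW ww0 w0.
  by rewrite -cI odd_double.
- have [I cI] := half_set.
  have [wW ww0] := norton_signs I (1 : R[i]) n_even cI.
  eexists; split; [exact: wW| |exact: ww0].
  (* Even n >= 3 means n >= 4, so [I] contains a pair; the entry there is 1 + 1, hence the vector is
     non-zero. *)
  have /card_gt1P[i [j [iI jI ij]]] : (1 < #|I|)%N.
    rewrite cI -leq_double even_halfK // ltn_neqAle hn andbT.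
    by apply: contraNneq n_even => <-.
  have ij2 : #|[set i; j]| == 2%N by rewrite cards2 ij.
  rewrite comb_signs.
  move=> /rowP/(_ (enum_rank (Sub [set i; j] ij2 : Omega n))).
  rewrite comb_entry enum_rankK mxE /= big_setU1 ?inE //= big_set1 iI jI.
  by move/eqP; rewrite -mulr2n pnatr_eq0.
move=> n_even w wW balanced; split=> [[a [I [cI ->]]]|n4 ww0].
  by have [] := norton_signs I a n_even cI.
(* The zero vector takes scalar 0, but a set of size n/2 must still be supplied. *)
have [w0|/eqP w0] := eqVneq w 0.
  by have [I cI] := half_set; exists 0, I; rewrite scale0r.
have [a [I [cI wE]]] := norton_sqr_eq0_signs w n0 n4 wW ww0 w0.
by exists a, I; split=> //; rewrite -[LHS]doubleK cI.
Qed.
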